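(* Let $S_1,S_2,\dots$ be iid unit-rate exponential random variables, $\zeta\in(0,1)$, $\theta\in\mathbb{R}$, and $V_\infty=\theta\sum_{k=1}^\infty\zeta^kS_k$. For every positive integer $m$, $$\mathbb{E}[(V_\infty)^m]=\theta^m\cdot m!\sum_{k=m}^\infty\pi_m(k)\,\zeta^k,$$ where $\pi_m(k)$ is the number of partitions of $k$ into $m$ positive parts.
   Context: $V_\infty$ is the limit as $n\to\infty$ of $V_n=\theta\sum_{k=1}^n\zeta^kS_k$. *)

(* Defs.v *)
From HB Require Import structures.
From mathcomp Require Import all_boot all_order all_algebra.
From mathcomp Require Import finmap.
From mathcomp Require Import all_classical all_reals all_analysis.

Set Implicit Arguments.
Unset Strict Implicit.
Unset Printing Implicit Defensive.

Import Order.TTheory GRing.Theory Num.Theory.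
Import numFieldNormedType.Exports.

Local Open Scope classical_set_scope.
Local Open Scope ring_scope.

(* Partitions of k into exactly m positive parts, written in nonincreasing
   order; no part of such a partition exceeds k, whence the type 'I_k.+1. *)
Definition partitions_into (m k : nat) : {set m.-tuple 'I_k.+1} :=
  [set t : m.-tuple 'I_k.+1 |
     let parts := [seq val i | i <- t] in
     [&& sorted geq parts, all (leq 1) parts & sumn parts == k]]%SET.

Definition npart (m k : nat) : nat := #|partitions_into m k|.

(* Mutual independence of the random variables X_i, i in D: the product rule
   for every finite subfamily and all measurable events. *)
Definition mutually_independent d (T : measurableType d) (R : realType)
    (P : probability T R) (I : choiceType) (D : set I)
    (X : I -> {RV P >-> R}) : Prop :=
  forall (J : {fset I}) (A : I -> set R),
    [set` J] `<=` D ->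
    (forall i, i \in J -> measurable (A i)) ->
    (P (\bigcap_(i in [set` J]) (X i @^-1` A i)) =
     \prod_(i <- J) P (X i @^-1` A i))%E.

(* Equality of laws is required on measurable sets only: the value of a
   measure on a nonmeasurable set carries no meaning. *)
Definition exponential_law d (T : measurableType d) (R : realType)
    (P : probability T R) (rate : R) (X : {RV P >-> R}) : Prop :=
  forall A : set R, measurable A ->
    distribution P X A = exponential_prob rate A.

(* The sequence is S_1, S_2, ...: the term S 0 plays no role. *)
Definition iid_exponential d (T : measurableType d) (R : realType)
    (P : probability T R) (rate : R) (S : nat -> {RV P >-> R}) : Prop :=
  mutually_independent [set k | (0 < k)%N] S /\
  forall k, (0 < k)%N -> exponential_law rate (S k).

Definition V_ (T : Type) (R : realType) (theta zeta : R) (S : nat -> T -> R)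
    (n : nat) (w : T) : R :=
  theta * \sum_(1 <= k < n.+1) zeta ^+ k * S k w.

(* For zeta in (0, 1) and iid exponential S_k, the limit exists almost surely;
   where it does not exist, limn is a default value, which does not affect
   expectations. *)
Definition V_infty (T : Type) (R : realType) (theta zeta : R)
    (S : nat -> T -> R) (w : T) : R :=
  limn (fun n => V_ theta zeta S n w).

(* Main.v *)
Require Import Defs.
From HB Require Import structures.
From mathcomp Require Import all_boot all_order all_algebra.
From mathcomp Require Import finmap.
From mathcomp Require Import all_classical all_reals all_analysis.
From mathcomp Require Import measurable_realfun.
From mathcomp Require Import zify ring.

(** Let [W n] be the sum of [zeta ^+ k * `|S k|] over [1 <= k <= n]; almost
    surely the [S k] are nonnegative, so that [theta * W n] is the partial sum
    [V_n]. The key is that [E (W n) ^ j = j! * h_j], where [h_j] is the complete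
    homogeneous symmetric polynomial of degree [j] evaluated at [zeta],
    [zeta ^ 2], ..., [zeta ^ n]. Indeed the binomial expansion of
    [(W n + zeta ^ (n+1) S_(n+1)) ^ j], independence and the moments
    [E S ^ a = a!] of the exponential law give, the factorials cancelling the
    binomial coefficients,
<<
      E (W (n+1)) ^ j / j! = sum_l (E (W n) ^ l / l!) * (zeta ^ (n+1)) ^ (j-l),
>>
    which is the recursion that [h_j] obeys when a variable is added.

    A monomial of [h_j] at these powers of [zeta] is [zeta ^ k], where [k] is
    the sum of a multiset of [j] elements of [{1, ..., n}], that is, of a
    partition of [k] into [j] parts that do not exceed [n]. Hence [h_j] is the
    generating function [partition_gf zeta j n] of these partitions, and it
    increases with [n] to the generating function of all the partitions into
    [j] parts, which is finite since it is at most
    [(zeta / (1 - zeta)) ^ j].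

    As [W n] is nonnegative and nondecreasing in [n], monotone convergence
    carries the moment of order [m] to the limit. The limit moment is finite and
    [m > 0], so the sequence [W n] is almost surely bounded: the series
    converges, and [V_infty] is [theta] times its sum. *)

Set Implicit Arguments.
Unset Strict Implicit.

Import Order.TTheory GRing.Theory Num.Theory.
Import numFieldNormedType.Exports.

Local Open Scope classical_set_scope.
Local Open Scope ring_scope.

(** * Partitions with bounded parts *)

(** The nonincreasing sequences of [m] integers between [1] and [n], listed
    according to their largest part [i], which bounds the remaining ones. *)
Fixpoint bounded_partitions (m n : nat) : seq (seq nat) :=
  if m is m'.+1 then
    [seq i :: t | i <- iota 1 n, t <- bounded_partitions m' i]
  else [:: [::]].

Lemma mem_bounded_partitions (m n : nat) (t : seq nat) :
  (t \in bounded_partitions m n) =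
  [&& size t == m, sorted geq t, all (leq 1) t & all (geq n) t].
Proof.
elim: m n t => [|m IH] n t; first by case: t.
apply/allpairsPdep/idP => [[i [u [+ + ->]]]|].
  rewrite mem_iota add1n ltnS IH => /andP[i1 iN] /and4P[/eqP su so u1 ui] /=.
  rewrite su eqxx /= path_sortedE; last by move=> x y z /=; lia.
  rewrite ui so i1 u1 iN /=; apply: sub_all ui => x /=; lia.
case: t => [|i u] //= /and4P[su + /andP[i1 u1] /andP[iN _]].
rewrite path_sortedE; last by move=> x y z /=; lia.
move=> /andP[ui so]; exists i, u; split=> //; first by rewrite mem_iota i1; lia.
by rewrite IH so u1 ui !andbT.
Qed.

Lemma uniq_bounded_partitions (m n : nat) : uniq (bounded_partitions m n).
Proof.
elim: m n => [|m IH] n //=; apply: allpairs_uniq_dep => //.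
  exact: iota_uniq.
by move=> [i t] [j u] _ _ /= [-> ->].
Qed.

(** No part of a partition of [k] exceeds [k], so that for [k <= n] bounding
    the parts by [n] excludes nothing. *)
Lemma npartE (m n k : nat) : (k <= n)%N ->
  npart m k = count (fun t => sumn t == k) (bounded_partitions m n).
Proof.
move=> kn; rewrite /npart cardE -size_filter.
rewrite -(size_map (fun t : m.-tuple 'I_k.+1 => [seq val i | i <- t])).
apply: perm_size; apply: uniq_perm.
- rewrite map_inj_uniq ?enum_uniq // => t u /(inj_map val_inj) tu.
  exact: val_inj.
- exact/filter_uniq/uniq_bounded_partitions.
move=> t; rewrite mem_filter mem_bounded_partitions.
apply/mapP/idP => [[u + ->]|/andP[/eqP st /and4P[/eqP sz so t1 _]]].
  rewrite mem_enum inE => /and3P[-> -> ->] /=.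
  rewrite size_map size_tuple eqxx /=; apply/allP => _ /mapP[i _ ->] /=.
  by have := ltn_ord i; rewrite ltnS => /leq_trans; apply.
have tk : all (fun i => i <= k)%N t.
  by rewrite -st; apply/allP => i it; rewrite sumnE (big_rem i it) leq_addr.
have val_inord : [seq val (inord i : 'I_k.+1) | i <- t] = t.
  rewrite -[RHS]map_id; apply/eq_in_map => i /(allP tk) ik.
  by rewrite /= inordK.
have szt : size [seq (inord i : 'I_k.+1) | i <- t] == m.
  by rewrite size_map sz.
exists (Tuple szt); last by rewrite /= -map_comp.
by rewrite mem_enum inE /= -map_comp /comp val_inord so t1 st eqxx.
Qed.

Lemma leq_count_npart (m n k : nat) :
  (count (fun t => sumn t == k) (bounded_partitions m n) <= npart m k)%N.
Proof.
rewrite (@npartE m (n + k)%N) ?leq_addl // -!size_filter.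
apply: uniq_leq_size; first exact/filter_uniq/uniq_bounded_partitions.
move=> t; rewrite !mem_filter !mem_bounded_partitions.
move=> /and5P[-> -> -> -> tn] /=; apply: sub_all tn => i /=; lia.
Qed.

Lemma sumn_bounded_partitions (m n : nat) (t : seq nat) :
  t \in bounded_partitions m n -> (m <= sumn t <= n * m)%N.
Proof.
elim: m n t => [|m IH] n t; first by rewrite inE => /eqP ->; rewrite muln0.
move=> /allpairsPdep[i [u [+ + ->]]].
rewrite mem_iota => /andP[i1 iN] /IH /andP[mu um] /=.
apply/andP; split; first lia.
rewrite add1n ltnS in iN.
by rewrite mulnS leq_add // (leq_trans um) // leq_mul2r iN orbT.
Qed.

Section GeneratingFunction.
Context {R : comPzRingType}.
Implicit Type x : R.

(** By the correspondence between multisets and partitions, this is the complete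
    homogeneous symmetric polynomial of degree [m] evaluated at [x], [x ^+ 2],
    ..., [x ^+ n]. *)
Definition partition_gf x (m n : nat) : R :=
  \sum_(t <- bounded_partitions m n) x ^+ sumn t.

Lemma partition_gf0 x n : partition_gf x 0 n = 1.
Proof. by rewrite /partition_gf big_seq1. Qed.

Lemma partition_gfS x m n :
  partition_gf x m.+1 n = \sum_(1 <= i < n.+1) x ^+ i * partition_gf x m i.
Proof.
rewrite /index_iota subn1 /partition_gf big_allpairs_dep.
apply: eq_bigr => i _; rewrite big_distrr.
by apply: eq_bigr => t _; rewrite exprD.
Qed.

Lemma partition_gfS0 x m : partition_gf x m.+1 0 = 0.
Proof. by rewrite partition_gfS big_geq. Qed.

(** The largest part is either at most [n] or equal to [n.+1]; in the second
    case it can be removed. *)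
Lemma partition_gfSS x m n :
  partition_gf x m.+1 n.+1 =
  partition_gf x m.+1 n + x ^+ n.+1 * partition_gf x m n.+1.
Proof. by rewrite !partition_gfS big_nat_recr. Qed.

(** Splitting a partition into its parts at most [n], say [l] of them, and its
    [j - l] parts equal to [n.+1]. It is in this form that the generating
    function meets the binomial expansion of the moments. *)
Lemma partition_gf_convolution x j n :
  partition_gf x j n.+1 =
  \sum_(l < j.+1) partition_gf x l n * (x ^+ n.+1) ^+ (j - l).
Proof.
elim: j => [|j IH]; first by rewrite big_ord1 !partition_gf0 mulr1.
rewrite partition_gfSS IH [RHS]big_ord_recr /= subnn expr0 mulr1 addrC.
congr (_ + _); rewrite big_distrr /=; apply: eq_bigr => l _.
by rewrite subSn ?leq_ord // [_ ^+ (_ - _).+1]exprS mulrCA.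
Qed.

Lemma partition_gfE x m n N : (n * m < N)%N ->
  partition_gf x m n =
  \sum_(m <= k < N)
     (count (fun t => sumn t == k) (bounded_partitions m n))%:R * x ^+ k.
Proof.
move=> nmN; rewrite /partition_gf.
under [RHS]eq_bigr => k _.
  rewrite -sum1_count natr_sum big_distrl /= big_mkcond /=; over.
rewrite exchange_big /=; apply: eq_big_seq => t /sumn_bounded_partitions st.
rewrite -big_mkcond /=.
under eq_bigl do rewrite eq_sym.
by rewrite big_nat1_eq mul1r (_ : (m <= _ < N)%N) //; lia.
Qed.

End GeneratingFunction.

Section RealGeneratingFunction.
Context {R : realFieldType}.
Implicit Type x : R.

(** The bound is uniform in [n]: it is the [m]-th power of the sum of the
    geometric series, which counts ordered sequences of parts instead of
    sorted ones. *)
Lemma partition_gf_le x m n : 0 <= x -> x < 1 ->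
  partition_gf x m n <= (x / (1 - x)) ^+ m.
Proof.
move=> x0 x1; have y0 : 0 < 1 - x by rewrite subr_gt0.
elim: m n => [|m IH] n; first by rewrite partition_gf0.
(* The sum of the bounds on the contribution of each largest part is a partial
   geometric sum, kept in closed form to make the induction go through. *)
have gf_le k : partition_gf x m.+1 k <=
    (x / (1 - x)) ^+ m * ((x - x ^+ k.+1) / (1 - x)).
  elim: k => [|k IHk]; first by rewrite partition_gfS0 expr1 subrr mul0r mulr0.
  rewrite partition_gfSS (le_trans (lerD IHk (ler_wpM2l _ (IH _)))) //.
    exact: exprn_ge0.
  rewrite [leLHS](_ : _ = (x / (1 - x)) ^+ m *
    ((x - x ^+ k.+1) / (1 - x) + x ^+ k.+1)); last by ring.
  rewrite le_eqVlt; apply/orP; left; apply/eqP; congr (_ * _).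
  by rewrite [x ^+ k.+2]exprS; field; rewrite gt_eqF.
rewrite (le_trans (gf_le n)) // [_ ^+ m.+1]exprSr.
rewrite ler_wpM2l ?exprn_ge0 ?divr_ge0 ?(ltW y0) //.
by rewrite ler_wpM2r ?invr_ge0 ?(ltW y0) // gerBl exprn_ge0.
Qed.

Lemma npart_sum_le_partition_gf x m n : 0 <= x ->
  \sum_(m <= k < n.+1) (npart m k)%:R * x ^+ k <= partition_gf x m n.
Proof.
move=> x0; rewrite (@partition_gfE _ _ _ _ (n * m + n).+1); last by lia.
have [nm|mn] := ltnP n m.
  by rewrite big_geq // sumr_ge0 // => k _; rewrite mulr_ge0 ?exprn_ge0.
(* A partition of some k <= n has all its parts at most n, so that the terms up
   to n are equal; those beyond n are nonnegative. *)
rewrite [leRHS](big_cat_nat (n := n.+1)) /=; [|lia|lia].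
rewrite -[leLHS]addr0 lerD //; last first.
  by apply: sumr_ge0 => k _; rewrite mulr_ge0 ?exprn_ge0.
by apply: ler_sum_nat => k kn; rewrite (@npartE m n) //; lia.
Qed.

Lemma partition_gf_le_npart_sum x m n : 0 <= x ->
  partition_gf x m n <=
  \sum_(m <= k < (n * m).+1) (npart m k)%:R * x ^+ k.
Proof.
move=> x0; rewrite (@partition_gfE _ _ _ _ (n * m).+1) //.
apply: ler_sum => k _.
by rewrite ler_wpM2r ?exprn_ge0 // ler_nat leq_count_npart.
Qed.

End RealGeneratingFunction.

(** The generating function with parts at most [n] lies between the partial sum
    up to [n] of the series of all partitions and the sum of that series. *)
Lemma cvg_partition_gf (R : realType) (x : R) m : 0 <= x ->
  ((partition_gf x m n)%:E @[n --> \oo] -->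
   \sum_(m <= k <oo) ((npart m k)%:R * x ^+ k)%:E)%E.
Proof.
move=> x0; pose c k : R := (npart m k)%:R * x ^+ k.
have c0 k : (0 <= (c k)%:E)%E by rewrite lee_fin mulr_ge0 ?exprn_ge0.
apply: (@squeeze_cvge _ _ _ _ (fun n => \sum_(m <= k < n.+1) (c k)%:E)%E _
  (cst (\sum_(m <= k <oo) (c k)%:E)%E)).
- apply: nearW => n; rewrite sumEFin lee_fin npart_sum_le_partition_gf //=.
  apply: (le_trans _ (@nneseries_lim_ge _ _ _ _ (n * m).+1 _)) => //.
  by rewrite sumEFin lee_fin partition_gf_le_npart_sum.
- rewrite (cvg_shiftS (fun n => \sum_(m <= k < n) (c k)%:E)%E).
  by apply: is_cvg_nneseries => n _ _.
- exact: cvg_cst.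
Qed.

(** * Expectation of a product of independent variables *)

Section WeightedTransfer.
Context d d' {T : measurableType d} {T' : measurableType d'} {R : realType}.
Variables (mu : {measure set T -> \bar R}) (nu : {measure set T' -> \bar R}).
Variables (g : T -> R) (X : T -> T') (c : R).
Hypotheses (mg : measurable_fun setT g) (g_ge0 : forall x, 0 <= g x).
Hypothesis mX : measurable_fun setT X.
Hypothesis weighted_law : forall A, measurable A ->
  (\int[mu]_(x in X @^-1` A) (g x)%:E = c%:E * nu A)%E.

Local Open Scope ereal_scope.
Import HBNNSimple.

Lemma weighted_transfer_nnsfun (h : {nnsfun T' >-> R}) :
  \int[mu]_x ((g x)%:E * (h (X x))%:E) = c%:E * \int[nu]_y (h y)%:E.
Proof.
have mXA (A : set T') : measurable A -> measurable (X @^-1` A).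
  by move=> mA; rewrite -[X @^-1` A]setTI; exact: mX.
have mgE : measurable_fun [set: T] (EFin \o g) by exact/measurable_EFinP.
rewrite integralT_nnsfun sintegralE ge0_mule_fsumr; last first.
  by move=> r; exact: nnsfun_mulemu_ge0.
under eq_integral => x _.
  rewrite (fimfunE h) -fsumEFin // ge0_mule_fsumr; last first.
    by move=> r; exact: nnfun_muleindic_ge0.
  over.
rewrite ge0_integral_fsum //=; first last.
- by move=> r x _; rewrite mule_ge0 ?lee_fin //; exact: nnfun_muleindic_ge0.
- move=> r; apply: emeasurable_funM => //; apply/measurable_EFinP.
  apply: measurable_funM => //.
  by apply: (measurableT_comp _ mX); exact: measurable_indic.
apply: eq_fsbigr => r /[!inE] -[y _ <-{r}].
have hy0 : 0 <= (h y)%:E by rewrite lee_fin.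
under eq_integral do rewrite EFinM muleCA.
rewrite ge0_integralZl //; first last.
- by move=> x _; rewrite mule_ge0 // lee_fin.
- apply: emeasurable_funM => //; apply/measurable_EFinP.
  by apply: (measurableT_comp _ mX); exact: measurable_indic.
rewrite muleCA -weighted_law //; congr (_ * _).
rewrite [RHS]integral_mkcond; apply: eq_integral => x _.
by rewrite epatch_indic /= indicE [in RHS]indicE.
Qed.

(** Weighted change of variables: if the image under [X] of the measure of
    density [g] with respect to [mu] is [c] times [nu], then integrals follow.
    Taking [X] the identity and [c = 1] integrates against a law given by a
    density; taking [g] a product of the other factors and [nu] the law of [X]
    factors [X] out of an expectation. *)
Lemma weighted_transfer (f : T' -> \bar R) :
  measurable_fun setT f -> (forall y, 0 <= f y) ->
  \int[mu]_x ((g x)%:E * f (X x)) = c%:E * \int[nu]_y f y.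
Proof.
move=> mf f0; pose h := nnsfun_approx measurableT mf.
have cvh y : (h n y)%:E @[n --> \oo] --> f y by exact: cvg_nnsfun_approx.
have hnd y : {homo (fun n => (h n y)%:E) : n m / (n <= m)%N >-> n <= m}.
  by move=> n m nm; rewrite lee_fin; exact/lefP/nd_nnsfun_approx.
have mh n : measurable_fun setT (fun y => (h n y)%:E) by exact/measurable_EFinP.
transitivity (limn (fun n => \int[mu]_x ((g x)%:E * (h n (X x))%:E))).
  rewrite -monotone_convergence //; first last.
  - by move=> x _ n m nm; apply: lee_wpmul2l; [rewrite lee_fin|exact: hnd].
  - by move=> n x _; rewrite mule_ge0 ?lee_fin.
  - move=> n; apply: emeasurable_funM; first exact/measurable_EFinP.
    exact: (measurableT_comp (mh n) mX).
  by apply: eq_integral => x _; apply/esym/cvg_lim => //; exact: cvgeZl.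
under eq_fun do rewrite weighted_transfer_nnsfun.
apply/cvg_lim => //; apply: cvgeZl => //.
have -> : \int[nu]_y f y = \int[nu]_y limn (fun n => (h n y)%:E).
  by apply: eq_integral => y _; apply/esym/cvg_lim.
by apply: cvg_monotone_convergence => // n y _; rewrite lee_fin.
Qed.

End WeightedTransfer.

Section Independence.
Context d {T : measurableType d} {R : realType} (P : probability T R).
Context {I : choiceType} (D : set I) (S : I -> {RV P >-> R}).
Hypothesis indep_S : mutually_independent D S.
Variables (f : I -> R -> R) (e : I -> R).
Hypotheses (mf : forall i, measurable_fun setT (f i)).
Hypothesis f_ge0 : forall i x, 0 <= f i x.
Hypothesis ef : forall i, D i -> (\int[P]_w (f i (S i w))%:E = (e i)%:E)%E.

Let indic_prod (s : seq I) (A : I -> set R) (w : T) : R :=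
  \prod_(i <- s) \1_(A i) (S i w).

Lemma expectation_prod_indic (s : seq I) (A : I -> set R) :
  uniq s -> [set` s] `<=` D -> (forall i, measurable (A i)) ->
  (\int[P]_w (indic_prod s A w)%:E = \prod_(i <- s) P (S i @^-1` A i))%E.
Proof.
move=> us sD mA; pose J : {fset I} := [fset i | i in s]%fset.
have sJ : perm_eq s J.
  apply: uniq_perm; [exact: us|exact: fset_uniq|by move=> i; rewrite in_fset].
have Js : [set` J] = [set` s].
  by apply/seteqP; split=> i /=; rewrite (perm_mem sJ).
rewrite (perm_big _ sJ) /= -indep_S //; last by rewrite Js.
rewrite -[X in P X]setIT -integral_indic //; last first.
  apply: fin_bigcap_measurable => // i _.
  by rewrite -[_ @^-1` _]setTI; exact: measurable_funP.
apply: eq_integral => w _; congr (_%:E).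
rewrite Js /indic_prod indicE; case: (boolP (w \in _)) => [|].
  rewrite inE => wA; rewrite big1_seq // => i /andP[_ si].
  by rewrite indicE mem_set //; exact: wA.
rewrite notin_setE => wA.
have [i si nA] : exists2 i, i \in s & ~ (A i (S i w)).
  apply: contrapT => nex; apply: wA => i /= si.
  by apply: contrapT => nA; apply: nex; exists i.
by rewrite (big_rem i) //= indicE memNset ?mul0r.
Qed.

(** The product rule is known for indicators and is extended to nonnegative
    functions one index at a time: the factors in [s] are arbitrary, those in
    [t] are indicators. To treat a further index [x], the induction hypothesis
    with [x] among the indicators says that the measure whose density [g] is the
    product of the other factors is mapped by [S x] to a multiple of the law of
    [S x]; [weighted_transfer] then allows any nonnegative function of [S x]. *)
Lemma expectation_prod_mixed (s t : seq I) (A : I -> set R) :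
  uniq (s ++ t) -> [set` s ++ t] `<=` D -> (forall i, measurable (A i)) ->
  (\int[P]_w (\prod_(i <- s) f i (S i w) * indic_prod t A w)%:E =
   (\prod_(i <- s) e i)%:E * \prod_(i <- t) P (S i @^-1` A i))%E.
Proof.
elim: s t A => [|x s IH] t A ust stD mA.
  under eq_integral do rewrite big_nil mul1r.
  by rewrite big_nil mul1e expectation_prod_indic.
have pst : perm_eq ((x :: s) ++ t) (s ++ x :: t).
  by rewrite (perm_catCA [:: x] s t).
have uxt : uniq (s ++ x :: t) by rewrite -(perm_uniq pst).
have xtD : [set` s ++ x :: t] `<=` D.
  by move=> i /=; rewrite -(perm_mem pst); exact: stD.
have Dx : D x by apply: stD; rewrite /= mem_head.
have xt : x \notin t.
  by move: ust; rewrite /= mem_cat negb_or -andbA => /and3P[].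
pose g w := \prod_(i <- s) f i (S i w) * indic_prod t A w.
have mg : measurable_fun setT g.
  apply: measurable_funM; apply: measurable_prod => i _.
    exact: measurableT_comp.
  by apply: measurableT_comp => //; exact: measurable_indic.
have g_ge0 w : 0 <= g w.
  by rewrite mulr_ge0 // prodr_ge0 // => i _; rewrite indicE.
pose c := \prod_(i <- s) e i * fine (\prod_(i <- t) P (S i @^-1` A i))%E.
have PE : (\prod_(i <- t) P (S i @^-1` A i) =
   (fine (\prod_(i <- t) P (S i @^-1` A i)))%:E)%E.
  rewrite fineK // prode_fin_num // => i _; apply: fin_num_measure.
  by rewrite -[_ @^-1` _]setTI; exact: measurable_funP.
have law B : measurable B ->
    (\int[P]_(w in S x @^-1` B) (g w)%:E = c%:E * distribution P (S x) B)%E.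
  move=> mB; pose A' i := if i == x then B else A i.
  have A'x : A' x = B by rewrite /A' eqxx.
  have A't i : i \in t -> A' i = A i.
    by rewrite /A'; case: eqP => // ->; rewrite (negbTE xt).
  have mA' i : measurable (A' i) by rewrite /A'; case: ifP.
  have indicA' w : indic_prod (x :: t) A' w = \1_B (S x w) * indic_prod t A w.
    rewrite /indic_prod big_cons A'x; congr (_ * _).
    by apply: eq_big_seq => i /A't ->.
  have := IH (x :: t) A' uxt xtD mA'.
  rewrite big_cons A'x.
  rewrite (eq_big_seq (fun i => P (S i @^-1` A i))); last by move=> i /A't ->.
  rewrite muleCA PE -EFinM muleC => <-.
  rewrite integral_mkcond; apply: eq_integral => w _.
  by rewrite epatch_indic /= -EFinM indicA' mulrCA mulrC.
have mfx : measurable_fun setT (EFin \o f x) by exact/measurable_EFinP.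
have fx0 y : (0 <= (EFin \o f x) y)%E by rewrite lee_fin.
transitivity (\int[P]_w ((g w)%:E * (EFin \o f x) (S x w)))%E.
  by apply: eq_integral => w _; rewrite -EFinM big_cons -mulrA mulrC.
rewrite (weighted_transfer mg g_ge0 _ law) //.
rewrite ge0_integral_distribution // [X in (_ * X)%E]ef //.
by rewrite PE big_cons -!EFinM mulrC mulrA.
Qed.

End Independence.

(** * Moments of the exponential law *)

Section ExponentialMoments.
Context {R : realType}.
Implicit Types (a : nat) (x : R).

(** A primitive of [x ^+ a * expR (- x)], obtained by repeated integration by
    parts. *)
Fixpoint expXn_primitive a x : R :=
  if a is b.+1 then a%:R * expXn_primitive b x - x ^+ a * expR (- x)
  else - expR (- x).

Lemma is_derive_expXn_primitive a x :
  is_derive x (1 : R) (expXn_primitive a) (x ^+ a * expR (- x)).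
Proof.
elim: a => [|a IH] /=.
  rewrite [X in is_derive _ _ X _](_ : _ = - (expR \o -%R)); last exact/funext.
  by apply: is_derive_eq; ring.
rewrite [X in is_derive _ _ X _](_ : _ =
    a.+1%:R \*: expXn_primitive a - (@id R) ^+ a.+1 * (expR \o -%R)).
  by apply: is_derive_eq; rewrite ?exprfctE /GRing.scale /=; ring.
by apply/funext => y; rewrite exprfctE.
Qed.

Lemma expXn_primitive0 a : expXn_primitive a 0 = - a`!%:R.
Proof.
elim: a => [|a IH] /=; first by rewrite oppr0 expR0.
by rewrite IH expr0n mul0r subr0 factS natrM mulrN.
Qed.

(** The exponential exceeds its Taylor term of order [a.+1]. *)
Lemma cvg_exprn_expRN a : x ^+ a * expR (- x) @[x --> +oo] --> (0 : R).
Proof.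
apply/cvgrPdist_le => e e0; near=> x.
have x0 : 0 < x by near: x; exact: nbhs_pinfty_gt.
rewrite sub0r normrN ger0_norm ?mulr_ge0 ?exprn_ge0 ?expR_ge0 ?(ltW x0) //.
rewrite expRN ler_pdivrMr ?expR_gt0 //.
have fact0 : 0 < a.+1`!%:R :> R by rewrite ltr0n fact_gt0.
have xa : x ^+ a.+1 / a.+1`!%:R <= expR x.
  by rewrite (le_trans _ (expR_ge1Dxn a (ltW x0))) // lerDr.
rewrite -(ler_pM2l x0) -exprS mulrA.
apply: (@le_trans _ _ (a.+1`!%:R * expR x)).
  by rewrite -ler_pdivrMl // mulrC.
by rewrite ler_pM2r ?expR_gt0 // -ler_pdivrMr.
Unshelve. all: by end_near. Qed.

Lemma cvg_expXn_primitive a : expXn_primitive a x @[x --> +oo] --> (0 : R).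
Proof.
elim: a => [|a IH] /=; first by rewrite -oppr0; apply: cvgN; exact: cvgr_expR.
rewrite -[0]subr0 -[X in X - _](mulr0 a.+1%:R).
by apply: cvgB; [exact: cvgMr|exact: (cvg_exprn_expRN a.+1)].
Qed.

Lemma continuous_expXn_primitive a : continuous (expXn_primitive a).
Proof.
move=> x; apply/differentiable_continuous/derivable1_diffP.
exact: (@ex_derive _ _ _ _ _ _ _ (is_derive_expXn_primitive a x)).
Qed.

Lemma continuous_exprn_expRN a : continuous (fun x : R => x ^+ a * expR (- x)).
Proof.
move=> x; apply: cvgM; first exact: exprn_continuous.
apply: (@continuous_comp _ _ _ -%R expR); first exact: opp_continuous.
exact: continuous_expR.
Qed.

Lemma integral_exprn_expRN a :
  (\int[lebesgue_measure]_(x in `[0%R, +oo[) (x ^+ a * expR (- x))%:E =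
   a`!%:R%:E :> \bar R)%E.
Proof.
rewrite (@ge0_continuous_FTC2y _ _ (expXn_primitive a) 0 0).
- by rewrite expXn_primitive0 sub0e EFinN oppeK.
- by move=> x x0; rewrite mulr_ge0 ?exprn_ge0 ?expR_ge0.
- by apply: continuous_subspaceT; exact: continuous_exprn_expRN.
- exact: cvg_expXn_primitive.
- move=> x _; exact: (@ex_derive _ _ _ _ _ _ _ (is_derive_expXn_primitive a x)).
- by apply: cvg_at_right_filter; exact: continuous_expXn_primitive.
- move=> x _; rewrite derive1E.
  exact: (@derive_val _ _ _ _ _ _ _ (is_derive_expXn_primitive a x)).
Qed.

(** The absolute value changes nothing almost surely, and makes the integrand
    nonnegative everywhere. *)
Lemma expectation_exponential_exprn d (T : measurableType d)
    (P : probability T R) (X : {RV P >-> R}) a :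
  exponential_law 1 X -> (\int[P]_w (`|X w| ^+ a)%:E = a`!%:R%:E)%E.
Proof.
move=> lawX.
have mf : measurable_fun setT (fun x : R => (`|x| ^+ a)%:E).
  by apply/measurable_EFinP; apply: measurable_funX; exact: normr_measurable.
have f0 (x : R) : (0 <= (`|x| ^+ a)%:E)%E by rewrite lee_fin exprn_ge0.
rewrite -(ge0_integral_distribution X mf f0) -[LHS]mul1e.
have pdf_ge0 (x : R) : 0 <= exponential_pdf 1 x by exact: exponential_pdf_ge0.
have mpdf := measurable_exponential_pdf (1 : R).
have law (A : set R) : measurable A ->
    (\int[lebesgue_measure]_(x in idfun @^-1` A) (exponential_pdf 1 x)%:E =
     1%:E * distribution P X A)%E.
  by move=> mA; rewrite mul1e [RHS]lawX.
rewrite -(@weighted_transfer _ _ (measurableTypeR R) R R lebesgue_measure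
  (distribution P X) _ idfun 1 mpdf pdf_ge0 (@measurable_id _ _ _) law _ mf f0).
rewrite -integral_exprn_expRN [RHS]integral_mkcond.
apply: eq_integral => x _; rewrite /exponential_pdf !patchE.
case: ifPn => [|_]; last by rewrite mul0e.
rewrite inE /= in_itv /= andbT => x0.
by rewrite mul1r mulN1r ger0_norm // -EFinM mulrC.
Qed.

End ExponentialMoments.

Lemma exponential_law_ge0 d (T : measurableType d) (R : realType)
    (P : probability T R) (X : {RV P >-> R}) (rate : R) :
  exponential_law rate X -> \forall w \ae P, 0 <= X w.
Proof.
move=> lawX; exists (X @^-1` `]-oo, 0[); split.
- by rewrite -[_ @^-1` _]setTI; exact: measurable_funP.
- rewrite -[LHS]/(distribution P X `]-oo, 0[%classic) lawX //.
  rewrite /exponential_prob integral0_eq // => x /=.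
  by rewrite in_itv /= => x0; rewrite lt0_exponential_pdf.
- by move=> w /negP; rewrite -ltNge /= in_itv.
Qed.

(** * Limits of sequences of functions *)

(** An extended real equal to the injection of its real part is finite: the
    right-hand side says that the lower and the upper limit are finite and
    agree, in a form whose measurability in a parameter is immediate. *)
Lemma is_cvgn_limn_esupP {R : realType} (u : nat -> R) :
  let L := limn_esup (EFin \o u) in
  cvgn u <-> (limn_einf (EFin \o u) == (fine L)%:E) && (L == (fine L)%:E).
Proof.
move=> L; split=> [cu|/andP[/eqP infL /eqP supL]].
  have cuE : (EFin \o u) @ \oo --> (limn u)%:E.
    by apply: cvg_EFin; [exact: nearW|exact: cu].
  have [-> LE] := cvg_limn_einf_sup cuE.
  by rewrite /L LE /= eqxx.
apply/cvg_ex; exists (fine L).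
suff : (EFin \o u) @ \oo --> (fine L)%:E by move=> /fine_cvgP[].
apply: (@squeeze_cvge _ _ _ _ (einfs (EFin \o u)) _ (esups (EFin \o u))).
- apply: nearW => n; apply/andP; split.
    by apply: ereal_inf_lbound; exists n => //=.
  by apply: ereal_sup_ubound; exists n => //=.
- by rewrite -infL limn_einf_lim; exact: is_cvg_einfs.
- by rewrite -supL /L limn_esup_lim; exact: is_cvg_esups.
Qed.

(** No convergence is assumed: the set where the sequence converges is
    measurable, on it the limit is the upper limit, and off it the limit is a
    constant default value. *)
Lemma measurable_limn d (T : measurableType d) (R : realType)
    (h : nat -> T -> R) :
  (forall n, measurable_fun setT (h n)) ->
  measurable_fun setT (fun w => limn (h ^~ w)).
Proof.
move=> mh; pose u w n := (h n w)%:E.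
have mu n : measurable_fun setT (u ^~ n) by exact/measurable_EFinP.
have mL : measurable_fun setT (fun w => limn_esup (u w)).
  exact: measurable_fun_limn_esup.
have mfL : measurable_fun setT (fun w => (fine (limn_esup (u w)))%:E).
  by apply/measurable_EFinP; exact: measurableT_comp.
have ml : measurable_fun setT (fun w => limn_einf (u w)).
  rewrite /limn_einf; apply: measurableT_comp => //.
  apply: (@measurable_fun_limn_esup _ _ _ _ (fun n w => - u w n)%E) => n.
  exact: measurableT_comp.
pose c w := (limn_einf (u w) == (fine (limn_esup (u w)))%:E) &&
            (limn_esup (u w) == (fine (limn_esup (u w)))%:E).
rewrite (_ : (fun w => _) =
    (fun w => if c w then fine (limn_esup (u w)) else (point : R))).
  apply: measurable_fun_ifT => //.
    by apply: measurable_and; exact: measurable_fun_eqe.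
  exact: measurableT_comp.
apply/funext => w; case: ifPn => [cw|/negP ncw]; last first.
  by apply: dvgP => cvh; apply: ncw; exact/is_cvgn_limn_esupP.
have cvh : cvgn (h ^~ w) by apply/is_cvgn_limn_esupP.
have cuE : u w @ \oo --> (limn (h ^~ w))%:E.
  by apply: cvg_EFin; [exact: nearW|exact: cvh].
by have [_ ->] := cvg_limn_einf_sup cuE.
Qed.

(** A finite limit of the powers bounds the sequence itself, which converges
    since it is monotone. *)
Lemma cvgn_of_cvg_exprn (R : realType) (u : nat -> R) m :
  (0 < m)%N -> nondecreasing_seq u -> (forall n, 0 <= u n) ->
  limn (fun n => (u n ^+ m)%:E) \is a fin_num ->
  cvgn u /\ ((limn u) ^+ m)%:E = limn (fun n => (u n ^+ m)%:E).
Proof.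
move=> m0 undec u0; set y := limn _ => yfin.
have upow_nd : nondecreasing_seq (fun n => (u n ^+ m)%:E).
  by move=> i j ij; rewrite lee_fin lerXn2r ?nnegrE // undec.
have u_le n : u n ^+ m <= fine y.
  rewrite -lee_fin fineK // /y.
  rewrite (cvg_lim _ (ereal_nondecreasing_cvgn upow_nd)) //.
  by apply: ereal_sup_ubound; exists n.
have cu : cvgn u.
  apply: nondecreasing_is_cvgn => //; exists (Num.max 1 (fine y)) => _ [n _ <-].
  rewrite le_max; have [//|u1 /=] := leP (u n) 1.
  by rewrite (le_trans _ (u_le n)) // ler_eXnr // ltW.
split=> //; apply/esym/cvg_lim => //.
apply: cvg_EFin; first exact: nearW.
exact: (@continuous_cvg _ _ _ _ _ u _ _ (@exprn_continuous _ m _) cu).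
Qed.

(** * Moments of the partial sums and of their limit *)

Section Moments.
Context d {T : measurableType d} {R : realType} (P : probability T R).
Variables (S : nat -> {RV P >-> R}) (zeta : R).
Hypotheses (hS : iid_exponential 1 S) (zeta_ge0 : 0 <= zeta).

(** With absolute values the sums are nonnegative and nondecreasing in [n]
    everywhere, not just almost surely. *)
Definition abs_sum (n : nat) (w : T) : R :=
  \sum_(1 <= k < n.+1) zeta ^+ k * `|S k w|.

Lemma abs_sumS n w :
  abs_sum n.+1 w = abs_sum n w + zeta ^+ n.+1 * `|S n.+1 w|.
Proof. by rewrite /abs_sum big_nat_recr. Qed.

Lemma abs_sum_ge0 n w : 0 <= abs_sum n w.
Proof. by apply: sumr_ge0 => k _; rewrite mulr_ge0 ?exprn_ge0. Qed.

Lemma measurable_abs_sum n : measurable_fun setT (abs_sum n).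
Proof.
apply: measurable_sum => k; apply: measurable_funM => //.
exact: measurableT_comp.
Qed.

(** The factors of index greater than [n] make the induction on [n] possible:
    expanding the power of [abs_sum n.+1] produces powers of [S n.+1], which the
    induction hypothesis absorbs among these factors. *)
Lemma expectation_abs_sum_exprn_prod n j (s : seq nat) (a : nat -> nat) :
  uniq s -> all (ltn n) s ->
  (\int[P]_w (abs_sum n w ^+ j * \prod_(i <- s) `|S i w| ^+ a i)%:E =
   (j`!%:R * partition_gf zeta j n * \prod_(i <- s) (a i)`!%:R)%:E)%E.
Proof.
elim: n j s a => [|n IH] j s a us ns.
  have -> : abs_sum 0 = cst 0 by apply/funext => w; rewrite /abs_sum big_geq.
  case: j => [|j]; last first.
    rewrite partition_gfS0 mulr0 mul0r integral0_eq // => w _.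
    by rewrite expr0n mul0r.
  under eq_integral do rewrite expr0 mul1r.
  rewrite partition_gf0 fact0 mulr1 mul1r.
  have := @expectation_prod_mixed _ _ _ P _ _ S hS.1
    (fun i x => `|x| ^+ a i) (fun i => (a i)`!%:R) _ _ _ s [::] (fun=> setT).
  rewrite big_nil mule1 => <- //.
  - by apply: eq_integral => w _; rewrite big_nil mulr1.
  - by move=> i; apply: measurable_funX; exact: normr_measurable.
  - by move=> i i0; apply: expectation_exponential_exprn; exact: hS.2.
  - by rewrite cats0.
  - by move=> i /=; rewrite cats0 => /(allP ns).
have n1s : n.+1 \notin s by apply/negP => /(allP ns) /=; rewrite ltnn.
(* A term of the binomial expansion, with the power of S n.+1 that it contains
   added to the product. *)
pose a' l i := if i == n.+1 then l else a i.
pose term (l : nat) w :=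
  abs_sum n w ^+ l * \prod_(i <- n.+1 :: s) `|S i w| ^+ a' (j - l)%N i.
have a's l i : i \in s -> a' l i = a i.
  by rewrite /a'; case: eqP => // ->; rewrite (negbTE n1s).
have mterm l : measurable_fun setT (term l).
  apply: measurable_funM; first exact/measurable_funX/measurable_abs_sum.
  apply: measurable_prod => i _; apply: measurable_funX.
  exact: measurableT_comp.
have term_ge0 l w : 0 <= term l w.
  by rewrite mulr_ge0 ?exprn_ge0 ?abs_sum_ge0 // prodr_ge0.
pose k (l : 'I_j.+1) : R := (zeta ^+ n.+1) ^+ (j - l) *+ 'C(j, l).
have k_ge0 l : 0 <= k l by rewrite mulrn_wge0 ?exprn_ge0.
transitivity (\int[P]_w (\sum_(l < j.+1) (k l)%:E * (term l w)%:E))%E.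
  apply: eq_integral => w _; under [RHS]eq_bigr do rewrite -EFinM.
  rewrite sumEFin; congr (_%:E).
  rewrite abs_sumS addrC exprDn big_distrl /=; apply: eq_bigr => l _.
  rewrite /term big_cons {1}/a' eqxx exprMn.
  rewrite [in RHS](eq_big_seq (fun i => `|S i w| ^+ a i)); last first.
    by move=> i /a's ->.
  by rewrite /k -mulrnAl; ring.
rewrite ge0_integral_sum //; last 2 first.
- by move=> l; apply: measurable_funeM; exact/measurable_EFinP.
- by move=> l w _; rewrite mule_ge0 ?lee_fin.
rewrite partition_gf_convolution big_distrr big_distrl -sumEFin /=.
apply: eq_bigr => l _; rewrite ge0_integralZl_EFin //; last 2 first.
- by move=> w _; rewrite lee_fin.
- exact/measurable_EFinP.
rewrite IH /= ?n1s //; last first.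
  by rewrite ltnSn /=; apply: sub_all ns => i; exact: ltnW.
rewrite big_cons {1}/a' eqxx.
rewrite (eq_big_seq (fun i => (a i)`!%:R)); last by move=> i /a's ->.
rewrite -EFinM; congr (_%:E).
(* The factorials of l and j - l, from the two moments, cancel the binomial
   coefficient. *)
rewrite -(@bin_fact j l) -1?ltnS // !natrM /k -mulr_natl; ring.
Qed.

Lemma expectation_abs_sum_exprn n j :
  (\int[P]_w (abs_sum n w ^+ j)%:E = (j`!%:R * partition_gf zeta j n)%:E)%E.
Proof.
have := @expectation_abs_sum_exprn_prod n j [::] (fun=> 0%N) isT isT.
rewrite big_nil mulr1 => <-.
by apply: eq_integral => w _; rewrite mulr1.
Qed.

End Moments.

Theorem corollary6p2 (R : realType) (d : measure_display)
    (T : measurableType d) (P : probability T R)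
    (S : nat -> {RV P >-> R}) (zeta theta : R) (m : nat)
    (hS : iid_exponential 1 S)
    (zeta_gt0 : 0 < zeta) (zeta_lt1 : zeta < 1) (m_gt0 : (0 < m)%N) :
  ('E_P[fun w => (V_infty theta zeta (fun k => S k) w ^+ m)%R] =
   (theta ^+ m * m`!%:R)%R%:E *
     \sum_(m <= k <oo) ((npart m k)%:R * zeta ^+ k)%R%:E)%E.
Proof.
have zeta_ge0 := ltW zeta_gt0.
set L := (\sum_(m <= k <oo) _)%E.
have gf_L := @cvg_partition_gf R zeta m zeta_ge0; rewrite -/L in gf_L.
pose W := @abs_sum _ _ _ P S zeta.
have W_nd w : nondecreasing_seq (W ^~ w).
  apply/nondecreasing_seqP => n.
  by rewrite /W abs_sumS lerDl mulr_ge0 ?exprn_ge0.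
have W_ge0 n w : 0 <= W n w by exact: abs_sum_ge0.
have mW n : measurable_fun setT (W n) by exact: measurable_abs_sum.
pose Y n w := (W n w ^+ m)%:E.
have Y_nd w : nondecreasing_seq (Y ^~ w).
  by move=> i j ij; rewrite lee_fin lerXn2r ?nnegrE // W_nd.
have mY n : measurable_fun setT (Y n).
  by apply/measurable_EFinP; exact: measurable_funX.
have Y_ge0 n w : (0 <= Y n w)%E by rewrite lee_fin exprn_ge0.
pose Yoo w := limn (Y ^~ w).
have Yoo_cvg w : Y ^~ w @ \oo --> Yoo w by exact: ereal_nondecreasing_is_cvgn.
have mYoo : measurable_fun setT Yoo.
  by apply: emeasurable_fun_cvg mY _ => w _.
have Yoo_ge0 w : (0 <= Yoo w)%E.
  by apply: lime_ge; [exact: ereal_nondecreasing_is_cvgn|exact: nearW].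
have int_Yoo : (\int[P]_w Yoo w = m`!%:R%:E * L)%E.
  rewrite (monotone_convergence P measurableT mY) //.
  apply/cvg_lim => //.
  under eq_fun do rewrite (expectation_abs_sum_exprn hS zeta_ge0) EFinM.
  exact: cvgeZl.
(* Finiteness is needed to factor out theta ^+ m, of arbitrary sign, and to make
   the partial sums converge almost surely. *)
have L_fin : L \is a fin_num.
  have L_ge0 : (0 <= L)%E.
    by apply: nneseries_ge0 => k _ _; rewrite lee_fin mulr_ge0 ?exprn_ge0.
  rewrite ge0_fin_numE //.
  apply: (@le_lt_trans _ _ ((zeta / (1 - zeta)) ^+ m)%:E); last exact: ltry.
  rewrite -(cvg_lim _ gf_L) //; apply: lime_le; first by apply/cvg_ex; exists L.
  by apply: nearW => n; rewrite lee_fin partition_gf_le.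
have iYoo : P.-integrable setT Yoo.
  apply/integrableP; split => //.
  under eq_integral do rewrite gee0_abs //.
  by rewrite int_Yoo ltey_eq fin_numM.
have VY : {ae P, forall w,
    (V_infty theta zeta (fun k => S k) w ^+ m)%:E =
    ((theta ^+ m)%:E * Yoo w)%E}.
  have S_ge0 : {ae P, forall w, forall k, 0 <= S k.+1 w}.
    by apply: ae_foralln => k; apply: exponential_law_ge0; exact: hS.2.
  have Yfin := integrable_ae measurableT iYoo.
  apply: filterS2 S_ge0 Yfin => w Sw /(_ Logic.I) Yw.
  have VW n : V_ theta zeta (fun k => S k) n w = theta * W n w.
    congr (_ * _); apply: eq_big_nat => -[//|k] _.
    by rewrite ger0_norm.
  have [cW limW] := cvgn_of_cvg_exprn m_gt0 (W_nd w) (W_ge0^~ w) Yw.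
  rewrite /V_infty; under eq_fun do rewrite VW.
  have -> : limn (fun n => theta * W n w) = theta * limn (W ^~ w).
    by apply/cvg_lim => //; exact: cvgMr.
  by rewrite exprMn EFinM limW.
rewrite unlock.
rewrite (ae_eq_integral (fun w => (theta ^+ m)%:E * Yoo w)%E) //; last 3 first.
- apply/measurable_EFinP; apply: measurable_funX; apply: measurable_limn => n.
  apply: measurable_funM => //; apply: measurable_sum => k.
  exact: measurable_funM.
- exact: measurable_funeM.
- by apply: filterS VY => w ? _.
by rewrite integralZl // int_Yoo EFinM muleA.
Qed.
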